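(* Let $X$ be a normed linear space (real or complex) and let $x, y \in S_X$ satisfy $\|x + \lambda y\| \ge 1$ for all scalars $\lambda$. Then there exists $\delta \ge \frac{1}{3}$ such that $\|t x + (1-t) y\| \ge \delta$ for all $t \in [0,1]$. If in addition $X$ is strictly convex, then such a $\delta$ exists with $\delta > \frac{1}{3}$.
   Context: $S_X = \{x \in X : \|x\| = 1\}$ and $B_X = \{x \in X : \|x\| \le 1\}$. $X$ is strictly convex iff every element of $S_X$ is an extreme point of $B_X$. *)

(* Defs.v *)
From HB Require Import structures.
From mathcomp Require Import all_boot all_order all_algebra.
From mathcomp Require Import complex.
From mathcomp Require Import boolp classical_sets reals topology normedtype.

Set Implicit Arguments.
Unset Strict Implicit.
Unset Printing Implicit Defensive.

Import Order.TTheory GRing.Theory Num.Theory.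
Import numFieldNormedType.Exports.

Local Open Scope classical_set_scope.
Local Open Scope ring_scope.

(* The scalar field K is meant to be R or R[i] for R : realType.  In R[i] the
   order is the partial one for which z <= w forces w - z to be real, so a
   parameter t : K with 0 < t < 1 is a real number, and the K-valued norm takes
   nonnegative real values. *)

Definition unit_sphere (K : numFieldType) (X : normedModType K) : set X :=
  [set x | `|x| = 1].

Definition unit_ball (K : numFieldType) (X : normedModType K) : set X :=
  [set x | `|x| <= 1].

Arguments unit_sphere {K} X _.
Arguments unit_ball {K} X _.

Definition extreme_point (K : numFieldType) (X : lmodType K) (A : set X)
    (x : X) : Prop :=
  A x /\ forall (a b : X) (t : K), A a -> A b -> 0 < t < 1 ->
    x = t *: a + (1 - t) *: b -> a = x /\ b = x.

Definition strictly_convex (K : numFieldType) (X : normedModType K) : Prop :=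
  forall x : X, unit_sphere X x -> extreme_point (unit_ball X) x.

(* Main.v *)
(** Write [f t = `|t x + (1 - t) y|].  Orthogonality gives [t <= f t] and the
    triangle inequality gives [1 - 2 t <= f t]; adding twice the first to the
    second yields [1 <= 3 f t].  If [f (1/3)] were [1/3] then [x + 2 y] would be
    a unit vector, and [x + y], which has norm at least 1, would be the midpoint
    of the unit vectors [x] and [x + 2 y], contradicting strict convexity.  So
    [c = f (1/3) > 1/3], and since [f] is 2-Lipschitz the bounds near and away
    from [1/3] combine into [f t >= (c + 2/3) / 3]. *)

Require Import Defs.
From HB Require Import structures.
From mathcomp Require Import all_boot all_order all_algebra.
From mathcomp Require Import complex ring.
From mathcomp Require Import boolp classical_sets reals topology normedtype.

Set Implicit Arguments.
Unset Strict Implicit.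
Unset Printing Implicit Defensive.

Import Order.TTheory GRing.Theory Num.Theory.
Import numFieldNormedType.Exports.

Local Open Scope classical_set_scope.
Local Open Scope complex_scope.
Local Open Scope ring_scope.

Section Segment.
Variables (K : numFieldType) (X : normedModType K) (x y : X).
Hypotheses (nx : `|x| = 1) (ny : `|y| = 1).
Hypothesis orth : forall l : K, 1 <= `|x + l *: y|.

Let f (t : K) := `|t *: x + (1 - t) *: y|.

(** For [t > 0] the vector is [t] times [x + (u / t) *: y], to which [orth] applies; leaving [u]
    arbitrary avoids any bound on [t] from above. *)
Lemma orthogonal_norm_ge (t u : K) : 0 <= t -> t <= `|t *: x + u *: y|.
Proof.
rewrite le_eqVlt => /predU1P[<-|t0]; first exact: normr_ge0.
have -> : t *: x + u *: y = t *: (x + (u / t) *: y).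
  by rewrite scalerDr scalerA mulrCA divff ?mulr1 // gt_eqF.
by rewrite normrZ gtr0_norm // ler_pMr.
Qed.

Lemma segment_norm_ge_triangle (t : K) : 0 <= t <= 1 -> 1 - 2 * t <= f t.
Proof.
move=> /andP[t0 t1]; have := lerB_normD ((1 - t) *: y) (t *: x).
rewrite !normrZ nx ny !mulr1 (ger0_norm t0) ger0_norm ?subr_ge0 // addrC.
by rewrite /f addrC; congr (_ <= _); [ring|rewrite addrC].
Qed.

Lemma segment_norm_ge (t : K) : 0 <= t <= 1 -> 1 / 3 <= f t.
Proof.
move=> t01; have /andP[t0 _] := t01.
have ft := orthogonal_norm_ge (1 - t) t0.
have fs := segment_norm_ge_triangle t01.
rewrite ler_pdivrMr ?ltr0n //.
have := lerD (lerD ft ft) fs; congr (_ <= _); rewrite /f; ring.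
Qed.

(** Passing from [t] to [s] adds [(s - t) *: (x - y)] to the vector, and [x - y] has norm at most
    2. *)
Lemma segment_norm_lipschitz (s t : K) : f s <= f t + 2 * `|s - t|.
Proof.
have -> : f s = `|(t *: x + (1 - t) *: y) + (s - t) *: (x - y)|.
  rewrite /f scalerBr addrACA -scalerDl -scalerBl.
  by congr (`|_ *: x + _ *: y|); ring.
apply: le_trans (ler_normD _ _) _; rewrite lerD2l normrZ mulrC ler_wpM2r //.
by apply: le_trans (ler_normB _ _) _; rewrite nx ny.
Qed.

Lemma third_norm_gt : strictly_convex X -> 1 / 3 < f (1 / 3).
Proof.
move=> sc; have third01 : 0 <= (1 / 3 : K) <= 1.
  by rewrite divr_ge0 //= ler_pdivrMr ?ltr0n // mul1r ler1n.
rewrite lt_neqAle segment_norm_ge // andbT; apply/eqP => fE.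
have n2 : `|x + 2 *: y| = 1.
  have -> : x + 2 *: y = 3 *: ((1 / 3) *: x + (1 - 1 / 3) *: y).
    rewrite scalerDr !scalerA -[x in LHS]scale1r.
    by congr (_ *: x + _ *: y); field.
  by rewrite normrZ -/(f _) -fE ger0_norm // mul1r divff ?pnatr_eq0.
have mid : x + y = (1 / 2) *: x + (1 - 1 / 2) *: (x + 2 *: y).
  rewrite scalerDr scalerA addrA -scalerDl.
  rewrite -[x in LHS]scale1r -[y in LHS]scale1r.
  by congr (_ *: x + _ *: y); field.
have half01 : 0 < (1 / 2 : K) < 1.
  by rewrite divr_gt0 //= ltr_pdivrMr ?ltr0n // mul1r ltr1n.
have /andP[h0 h1] := half01.
(* At most 1 by [mid] and the triangle inequality, at least 1 by [orth] at the scalar 1. *)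
have nm : `|x + y| = 1.
  apply/le_anti/andP; split; last by rewrite -[y]scale1r.
  rewrite mid; apply: le_trans (ler_normD _ _) _.
  rewrite (normrZ _ x) (normrZ _ (x + _)) nx n2 !mulr1 gtr0_norm //.
  by rewrite gtr0_norm ?subr_gt0 // [_ + (_ - _)]addrC subrK.
have [_ ext] := sc _ nm.
have [] := ext x (x + 2 *: y) (1 / 2) _ _ half01 mid;
  rewrite /unit_ball /= ?nx ?n2 // => xE _.
(* Extremality makes the endpoint [x] equal to the midpoint [x + y]. *)
have /eqP : y = 0 by apply: (addrI x); rewrite addr0 -xE.
by rewrite -normr_eq0 ny oner_eq0.
Qed.

Lemma segment_norm_ge_strict : strictly_convex X ->
  exists2 d : K, 1 / 3 < d & forall t : K, 0 <= t <= 1 -> d <= f t.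
Proof.
move=> sc; have c3 := third_norm_gt sc; set c := f _ in c3.
(* In each case below three lower bounds are added so that [t] cancels, leaving
   [c + 2 / 3 <= 3 * f t]. *)
exists ((c + 2 / 3) / 3).
  rewrite ltr_pdivlMr ?ltr0n // -subr_gt0.
  by move: c3; rewrite -subr_gt0; congr (_ < _); field.
move=> t t01; have /andP[t0 t1] := t01.
have lip : c <= f t + 2 * `|1 / 3 - t| := segment_norm_lipschitz _ _.
rewrite ler_pdivrMr ?ltr0n //.
(* The order of [K] may be partial, so comparing [t] with [1 / 3] requires both to be real. *)
have treal : t \is Num.real by rewrite ger0_real.
have third_real : (1 / 3 : K) \is Num.real by rewrite ger0_real ?divr_ge0.
case: (real_leP third_real treal) => [le3|/ltW le3].
(* For [t >= 1 / 3]: the Lipschitz bound plus twice [t <= f t]. *)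
- move: lip; rewrite distrC ger0_norm ?subr_ge0 // -(subr_ge0 c) => lip.
  have ft : 0 <= f t - t by rewrite subr_ge0 orthogonal_norm_ge.
  rewrite -subr_ge0.
  by have := addr_ge0 lip (addr_ge0 ft ft); congr (_ <= _); field.
(* For [t <= 1 / 3]: the Lipschitz bound plus [1 - 2 * t <= f t] and [1 / 3 <= f t]. *)
- move: lip; rewrite ger0_norm ?subr_ge0 // -(subr_ge0 c) => lip.
  have fs : 0 <= f t - (1 - 2 * t) by rewrite subr_ge0 segment_norm_ge_triangle.
  have f3 : 0 <= f t - 1 / 3 by rewrite subr_ge0 segment_norm_ge.
  rewrite -subr_ge0.
  by have := addr_ge0 lip (addr_ge0 fs f3); congr (_ <= _); field.
Qed.

End Segment.

Theorem theorem2p6 (R : realType) :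
  (forall (X : normedModType R) (x y : X),
     unit_sphere X x -> unit_sphere X y ->
     (forall lambda : R, 1 <= `|x + lambda *: y|) ->
     (exists delta : R, 1 / 3 <= delta /\
        forall t : R, 0 <= t <= 1 -> delta <= `|t *: x + (1 - t) *: y|) /\
     (strictly_convex X ->
      exists delta : R, 1 / 3 < delta /\
        forall t : R, 0 <= t <= 1 -> delta <= `|t *: x + (1 - t) *: y|))
  /\
  (forall (X : normedModType R[i]) (x y : X),
     unit_sphere X x -> unit_sphere X y ->
     (forall lambda : R[i], 1 <= `|x + lambda *: y|) ->
     (exists delta : R, 1 / 3 <= delta /\
        forall t : R, 0 <= t <= 1 ->
          delta%:C <= `|t%:C *: x + (1 - t)%:C *: y|) /\
     (strictly_convex X ->
      exists delta : R, 1 / 3 < delta /\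
        forall t : R, 0 <= t <= 1 ->
          delta%:C <= `|t%:C *: x + (1 - t)%:C *: y|)).
Proof.
split=> X x y nx ny orth; split.
- by exists (1 / 3); split=> // t; exact: segment_norm_ge.
- by move=> /(segment_norm_ge_strict nx ny orth)[d ? ?]; exists d.
- exists (1 / 3); split=> // t t01.
  have -> : (1 / 3)%:C = 1 / 3 :> R[i].
    by rewrite rmorphM fmorphV rmorph1 rmorph_nat.
  by rewrite rmorphB rmorph1; apply: segment_norm_ge => //; rewrite !lecR.
- move=> /(segment_norm_ge_strict nx ny orth)[d d3 dP].
  (* The bound [d] lives in [R[i]], but lying above [1 / 3] in the partial order forces it to be
     real, so its real part serves as [delta]. *)
  have dE : d = (complex.Re d)%:C.
    by rewrite RRe_real // gtr0_real // (lt_trans _ d3) // divr_gt0.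
  exists (complex.Re d); split.
    by rewrite -ltcR -dE rmorphM fmorphV rmorph1 rmorph_nat.
  by move=> t t01; rewrite -dE rmorphB rmorph1; apply: dP; rewrite !lecR.
Qed.
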